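(* Let $j,k\in\mathbb{Z}_{>0}$. Then $$\sum_{n=1}^{\infty}\frac{4^n}{n^{k+1}\binom{2n}{n}}\sum_{n\ge n_1\ge\cdots\ge n_{j-1}>n_j\ge 0}\frac{\binom{2n_j}{n_j}}{(2n_j+1)4^{n_j}}\prod_{i=1}^{j-1}\frac{1}{(2n_i-1)^2}=\frac{2^{k+3}}{(k-1)!}\int_0^1\frac{\ln^{k-1}\!\left(\frac{1+t^2}{2t}\right)\chi_{2j}(t)}{1+t^2}\,dt,$$ where the inner sum is over integers $n_1,\dots,n_j$; for $j=1$ the summation condition reads $n>n_1\ge 0$ and the product is empty (equal to $1$).
   Context: The Legendre chi function is $\chi_s(x):=\sum_{n=1}^{\infty}\frac{x^{2n-1}}{(2n-1)^s}$ for $|x|<1$, $s\in\mathbb{C}$ (also for $x=\pm1$ if $\Re(s)>1$). $\ln^{k-1}(\cdot)$ denotes the $(k-1)$-th power of the natural logarithm. *)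

(* Defs.v *)
From HB Require Import structures.
From mathcomp Require Import all_boot all_order all_algebra.
From mathcomp Require Import all_classical all_reals all_analysis.

Set Implicit Arguments.
Unset Strict Implicit.
Unset Printing Implicit Defensive.

Import Order.TTheory GRing.Theory Num.Theory.
Import numFieldNormedType.Exports.

Local Open Scope classical_set_scope.
Local Open Scope ring_scope.

(* sum_(n >= 1) x^(2n-1) / (2n-1)^s, for natural orders s only. As [limn] is
   total, the value is meaningful only where the series converges. *)
Definition legendre_chi (R : realType) (s : nat) (x : R) : R :=
  limn (fun N : nat =>
    \sum_(1 <= n < N.+1) x ^+ (2 * n - 1) / (2 * n - 1)%:R ^+ s).

(* The index n_i attached to the tuple m = (n_1, ..., n_j), with n_0 := n. *)
Definition idx (n j : nat) (m : j.-tuple 'I_n.+1) (i : nat) : nat :=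
  nth 0%N (n :: map val m) i.

(* n = n_0 >= n_1 >= ... >= n_(j-1) > n_j: only the last inequality is strict,
   so that for j = 1 the condition is n > n_1. *)
Definition admissible (n j : nat) (m : j.-tuple 'I_n.+1) : bool :=
  [forall i : 'I_j, if (i.+1 < j)%N then (idx m i.+1 <= idx m i)%N
                    else (idx m i.+1 < idx m i)%N].

(* All indices lie in [0, n], so ranging over tuples of elements of 'I_n.+1
   loses nothing. The subtraction 2 n_i - 1 takes place in R. *)
Definition inner_sum (R : realType) (j n : nat) : R :=
  \sum_(m : j.-tuple 'I_n.+1 | admissible m)
    'C(2 * idx m j, idx m j)%:R
      / ((2 * (idx m j)%:R + 1) * 4 ^+ idx m j)
    * \prod_(1 <= i < j) (1 / (2 * (idx m i)%:R - 1) ^+ 2).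

(* Main.v *)
Require Import Defs.
From HB Require Import structures.
From mathcomp Require Import all_boot all_order all_algebra.
From mathcomp Require Import all_classical all_reals all_analysis.
From mathcomp Require Import measurable_realfun ring lra.

Set Implicit Arguments.
Unset Strict Implicit.
Unset Printing Implicit Defensive.

Import Order.TTheory GRing.Theory Num.Theory.
Import numFieldNormedType.Exports.

Local Open Scope classical_set_scope.
Local Open Scope ring_scope.

(* Put x = 2t/(1+t^2), c = (1-t^2)/(1+t^2), b_n = binom(2n,n)/4^n, and let S_j(n)
   be the inner sum. With phi_n = c x^(2n+1)/((2n+1) b_n), psi_n = x^(2n+1)/b_n
   and theta = t d/dt, one has
     theta phi_n = psi_n - psi_(n+1),   theta psi_n = (2n+1)^2 phi_n.
   By Abel summation the partial sums of sum_n S_j(n+1) phi_n therefore satisfy,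
   up to a boundary term tending to 0 for t < 1, the recursion
   theta chi_(s+1) = chi_s of the partial sums of the chi series. Starting from
   artanh x = 2 artanh t, the mean value theorem propagates this to
     sum_n S_j(n+1) phi_n(t) = 2 chi_(2j)(t)   on [0, 1).
   Multiplying by (-ln x)^(k-1) dx/dt and integrating termwise (dominated
   convergence, and int_0^1 x^m (-ln x)^p dx = p!/(m+1)^(p+1)) gives the claim. *)

(** * The inner sum as a recursion in one variable, and the weights b_n *)

Section NestedSums.
Variable R : realType.
Implicit Types (j k n m : nat) (t x : R).

Definition cbin n : R := 'C(2 * n, n)%:R / 4 ^+ n.

(* Only [j > 0] is meaningful. *)
Fixpoint nested j n : R :=
  match j with
  | 0 => 1
  | j'.+1 => if j' is 0 then \sum_(0 <= m < n) cbin m / (2 * m + 1)%:R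
             else \sum_(0 <= m < n) nested j' m.+1 / (2 * m + 1)%:R ^+ 2
  end.

Arguments nested : simpl never.

Lemma nested1E n : nested 1 n = \sum_(0 <= m < n) cbin m / (2 * m + 1)%:R.
Proof. by []. Qed.

Lemma nestedSE j n :
  nested j.+2 n = \sum_(0 <= m < n) nested j.+1 m.+1 / (2 * m + 1)%:R ^+ 2.
Proof. by []. Qed.

Lemma nested0 j : nested j.+1 0 = 0.
Proof. by case: j => [|j]; rewrite (nested1E, nestedSE) big_geq. Qed.

(* Admissibility on lists: the bound [n] is decoupled from the ordinal type of
   the indices, which therefore stays fixed when a head index is split off. *)
Definition chain n (s : seq nat) : bool :=
  [forall i : 'I_(size s), if (i.+1 < size s)%N
     then (nth 0%N (n :: s) i.+1 <= nth 0%N (n :: s) i)%N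
     else (nth 0%N (n :: s) i.+1 < nth 0%N (n :: s) i)%N].

(** Reading n_j as [last n s] keeps the binomial factor unchanged when a head index is put in front
    of a nonempty list. *)
Definition chain_weight n (s : seq nat) : R :=
  'C(2 * last n s, last n s)%:R / ((2 * (last n s)%:R + 1) * 4 ^+ last n s)
    * \prod_(1 <= i < size s) (1 / (2 * (nth 0%N (n :: s) i)%:R - 1) ^+ 2).

Lemma chain1 n m : chain n [:: m] = (m < n)%N.
Proof.
rewrite /chain/=; apply/forallP/idP => [/(_ ord0)//|mn i].
by rewrite (ord1 i).
Qed.

Lemma chain_cons n m s : (0 < size s)%N ->
  chain n (m :: s) = (m <= n)%N && chain m s.
Proof.
move=> s0; rewrite /chain /=; apply/forallP/andP => [h|[mn /forallP h] i].
  split; first by have := h ord0; rewrite /= ltnS s0.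
  by apply/forallP => i; have := h (lift ord0 i).
by case: (unliftP ord0 i) => [i' ->|->] /=; [exact: h|rewrite ltnS s0].
Qed.

Lemma chain_weight1 n m : chain_weight n [:: m] = cbin m / (2 * m + 1)%:R.
Proof.
rewrite /chain_weight /cbin /= big_geq// mulr1 natrD natrM.
by rewrite invfM mulrA mulrAC.
Qed.

Lemma chain_weight_cons n m s : (0 < size s)%N ->
  chain_weight n (m :: s) = (2 * m%:R - 1) ^- 2 * chain_weight m s.
Proof.
move=> s0; rewrite /chain_weight /= big_ltn ?ltnS//= big_add1/= div1r.
by rewrite mulrCA.
Qed.

Lemma big_tuple_cons B j (P : pred (seq nat)) (F : seq nat -> R) :
  \sum_(s : j.+1.-tuple 'I_B | P (map val s)) F (map val s) =
  \sum_(i < B) \sum_(s : j.-tuple 'I_B | P (val i :: map val s))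
     F (val i :: map val s).
Proof.
rewrite pair_big_dep /=.
rewrite (reindex (fun p : 'I_B * j.-tuple 'I_B => [tuple of p.1 :: p.2]))//=.
exists (fun s : j.+1.-tuple 'I_B => (thead s, [tuple of behead s])).
  by move=> [i s] _ /=; congr pair; apply/val_inj.
by move=> s _; rewrite /= [RHS]tuple_eta.
Qed.

(** Induction on [j], splitting off the outermost index n_1, which then plays the role of [n]; [B]
    only bounds the range and stays fixed. *)
Lemma sum_chain B j n : (n < B)%N ->
  \sum_(s : j.+1.-tuple 'I_B | chain n (map val s)) chain_weight n (map val s)
  = nested j.+1 n.
Proof.
elim: j n => [|j IH] n nB.
  rewrite big_tuple_cons /= nested1E big_mkord.
  rewrite (big_ord_widen B (fun m => cbin m / (2 * m + 1)%:R) (ltnW nB)) [RHS]big_mkcond.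
  apply: eq_bigr => i _; rewrite big_mkcond (bigD1 [tuple])//= big1 ?addr0.
    by rewrite chain1 chain_weight1.
  by move=> s; rewrite (tuple0 s) => /eqP.
rewrite big_tuple_cons.
have E (i : 'I_B) : \sum_(s : j.+1.-tuple 'I_B | chain n (val i :: map val s))
     chain_weight n (val i :: map val s) =
  if (i < n.+1)%N then nested j.+1 i * (2 * i%:R - 1) ^- 2 else 0.
  rewrite ltnS; case: ifPn => [ni|ni].
    rewrite -IH// mulr_suml; apply: eq_big => s.
      by rewrite chain_cons ?size_map ?size_tuple// ni.
    by rewrite chain_weight_cons ?size_map ?size_tuple// mulrC.
  by rewrite big1// => s; rewrite chain_cons ?size_map ?size_tuple// (negbTE ni).
under eq_bigr do rewrite E.
rewrite -big_mkcond /= -(big_ord_widen B (fun i => nested j.+1 i * (2 * i%:R - 1) ^- 2))//.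
rewrite -(big_mkord xpredT (fun i => nested j.+1 i * (2 * i%:R - 1) ^- 2)).
(* The term n_1 = 0 vanishes, since no index lies strictly below 0; the shift n_1 = i + 1 then turns
   2 n_1 - 1 into 2 i + 1. *)
rewrite big_ltn// big_add1/=.
rewrite nested0 mul0r add0r nestedSE; apply: eq_bigr => i _.
by congr (_ * _ ^- 2); rewrite natrD natrM -natr1; ring.
Qed.

Lemma inner_sumE j n : inner_sum R j.+1 n = nested j.+1 n.
Proof.
rewrite -(@sum_chain n.+1)//; apply: eq_big => [s|s _].
  rewrite /admissible /chain /idx /=.
  apply/forallP/forallP => h i.
    by move: i; rewrite size_map size_tuple => i; exact: h.
  have e : j.+1 = size [seq val i | i <- s] by rewrite size_map size_tuple.
  by have := h (cast_ord e i); rewrite /= -e.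
have e : size [seq val i | i <- s] = j.+1 by rewrite size_map size_tuple.
by rewrite /chain_weight (last_nth 0%N) e.
Qed.

Lemma nestedS j n : nested j.+2 n.+1 - nested j.+2 n =
  nested j.+1 n.+1 / (2 * n + 1)%:R ^+ 2.
Proof. by rewrite !nestedSE big_nat_recr//= addrAC subrr add0r. Qed.

Lemma nested1S n : nested 1 n.+1 - nested 1 n = cbin n / (2 * n + 1)%:R.
Proof. by rewrite !nested1E big_nat_recr//= addrAC subrr add0r. Qed.

Lemma cbin_gt0 n : 0 < cbin n.
Proof. by rewrite divr_gt0 ?exprn_gt0 ?ltr0n// bin_gt0 leq_pmull. Qed.

Lemma cbinS n : (2 * n + 2)%:R * cbin n.+1 = (2 * n + 1)%:R * cbin n.
Proof.
rewrite /cbin exprS.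
suff h : (n.+1%:R * 'C(2 * n.+1, n.+1)%:R = 2 * (2 * n + 1)%:R * 'C(2 * n, n)%:R :> R).
  have -> : (2 * n + 2)%:R = 2 * n.+1%:R :> R by rewrite -natrM mulnS addnC.
  have : 4 ^+ n != 0 :> R by rewrite expf_neq0// pnatr_eq0.
  rewrite mulrA -(mulrA 2) h => /= h4.
  by field.
rewrite -!natrM; congr (_%:R).
(* Both factors come from passing through binom(2n+1, n). *)
have h1 : (n.+1 * 'C(2 * n.+1, n.+1) = 2 * n.+1 * 'C(2 * n + 1, n))%N.
  by rewrite -mul_bin_diag mulnS add2n addn1.
have h2 : (n.+1 * 'C(2 * n + 1, n) = (2 * n + 1) * 'C(2 * n, n))%N.
  have := mul_bin_down (2 * n + 1) n.
  have -> : (2 * n + 1 - n = n.+1)%N by rewrite mul2n -addnn -addnA addKn addn1.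
  by rewrite {2}addn1.
by rewrite h1 -mulnA h2 mulnA.
Qed.

End NestedSums.

Arguments nested : simpl never.

(** * Pointwise differentiation rules and a mean value estimate *)

Section DeriveFun.
Variable R : realType.
Implicit Types (f g : R -> R) (t a b : R).

Lemma is_derive_addf f g t a b : is_derive t 1 f a -> is_derive t 1 g b ->
  is_derive t 1 (fun s => f s + g s) (a + b).
Proof. exact: is_deriveD. Qed.

Lemma is_derive_mulf f g t a b : is_derive t 1 f a -> is_derive t 1 g b ->
  is_derive t 1 (fun s => f s * g s) (a * g t + f t * b).
Proof.
move=> df dg; have := is_deriveM df dg.
by move/is_derive_eq; apply; rewrite addrC mulrC.
Qed.

Lemma is_derive_cmulf k f t a : is_derive t 1 f a ->
  is_derive t 1 (fun s => k * f s) (k * a).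
Proof. exact: is_deriveZ. Qed.

Lemma is_derive_powf f n t a : is_derive t 1 f a ->
  is_derive t 1 (fun s => f s ^+ n.+1) (n.+1%:R * f t ^+ n * a).
Proof.
move=> df; have := is_deriveX n.+1 df.
by congr (is_derive _ _ _ _); apply/funext => s; rewrite exprfctE.
Qed.

Lemma is_derive_invf f t a : is_derive t 1 f a -> f t != 0 ->
  is_derive t 1 (fun s => (f s)^-1) (- f t ^- 2 * a).
Proof. by move=> df f0; exact: is_deriveV. Qed.

Lemma is_derive_sumf n (F : nat -> R -> R) t (D : nat -> R) :
  (forall i, is_derive t 1 (F i) (D i)) ->
  is_derive t 1 (fun s => \sum_(0 <= i < n) F i s) (\sum_(0 <= i < n) D i).
Proof.
move=> h; rewrite big_mkord.
have -> : (fun s => \sum_(0 <= i < n) F i s) = \sum_(i < n) F i.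
  by apply/funext => s; rewrite big_mkord fct_sumE.
exact: is_derive_sum.
Qed.

Lemma is_derive_continuous f t a : is_derive t 1 f a -> {for t, continuous f}.
Proof. by move=> df; apply/differentiable_continuous/derivable1_diffP. Qed.

(** The hypothesis bounds theta f = s f'(s) by e s, that is, f' by e on (0, r], and the mean value
    theorem returns the same linear bound for f. As the shape e t is reproduced, the estimate can be
    iterated along the recursion in theta. *)
Lemma normr_le_of_derive f (df : R -> R) (r e : R) :
  (forall s : R, is_derive s 1 f (df s)) -> f 0 = 0 ->
  (forall s : R, 0 < s <= r -> `|s * df s| <= e * s) ->
  forall t, 0 <= t <= r -> `|f t| <= e * t.
Proof.
move=> dfE f0 h t /andP[+ tr]; rewrite le_eqVlt => /predU1P[<-|t0].
  by rewrite f0 normr0 mulr0.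
have cf : {within `[0, t], continuous f}.
  by apply: continuous_subspaceT => s; exact: is_derive_continuous (dfE s).
have [c] := MVT t0 (fun s _ => dfE s) cf.
rewrite in_itv/= f0 !subr0 => /andP[c0 ct] ->.
rewrite normrM (gtr0_norm t0) ler_pM2r//.
have := h c; rewrite c0 (le_trans (ltW ct) tr) => /(_ isT).
by rewrite normrM (gtr0_norm c0) mulrC ler_pM2r.
Qed.

End DeriveFun.

(** * The half-angle substitution and the functions phi_n, psi_n *)

Section TanHalf.
Variable R : realType.
Implicit Types (j k n m N : nat) (r t : R).

(* With [t = tan (y / 2)], [tsin t] is [sin y], [tcos t] is [cos y] and
   [twt t] is [dy / dt]. *)
Definition twt t : R := 2 / (1 + t ^+ 2).
Definition tsin t : R := t * twt t.
Definition tcos t : R := twt t - 1.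

Lemma sqrD1_gt0 t : 0 < 1 + t ^+ 2.
Proof. by rewrite ltr_wpDr ?sqr_ge0. Qed.

Lemma twt_gt0 t : 0 < twt t.
Proof. by rewrite divr_gt0 ?sqrD1_gt0. Qed.

Lemma twtE t : twt t * (1 + t ^+ 2) = 2.
Proof. by rewrite /twt divfK// gt_eqF ?sqrD1_gt0. Qed.

Lemma tcos_sqr t : tcos t ^+ 2 = 1 - tsin t ^+ 2.
Proof.
have -> : 1 - tsin t ^+ 2 = 1 - twt t * (twt t * (1 + t ^+ 2) - twt t).
  by rewrite /tsin; ring.
by rewrite twtE /tcos; ring.
Qed.

Lemma is_derive_twt t : is_derive t 1 twt (- (tsin t * twt t)).
Proof.
have h : 1 + t ^+ 2 != 0 by rewrite gt_eqF ?sqrD1_gt0.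
have d : is_derive t 1 (fun s : R => 1 + s ^+ 2) (0 + 2 * t ^+ 1 * 1).
  by apply: is_derive_addf; apply: is_derive_powf.
apply: is_derive_eq (is_derive_cmulf 2 (is_derive_invf d h)) _.
by rewrite /tsin /twt; field.
Qed.

Lemma is_derive_tsin t : is_derive t 1 tsin (twt t * tcos t).
Proof.
apply: is_derive_eq (is_derive_mulf (is_derive_id _ _) (is_derive_twt t)) _.
have -> : 1 * twt t + t * - (tsin t * twt t) = twt t * (1 - (twt t * (1 + t ^+ 2) - twt t)).
  by rewrite /tsin; ring.
by rewrite twtE /tcos; ring.
Qed.

Lemma is_derive_tcos t : is_derive t 1 tcos (- (tsin t * twt t)).
Proof.
by rewrite -[X in is_derive _ _ _ X]addr0; apply: is_derive_addf (is_derive_twt t) _.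
Qed.

Lemma tsin0 : tsin 0 = 0. Proof. exact: mul0r. Qed.

Lemma tsin1 : tsin 1 = 1.
Proof. by rewrite /tsin mul1r /twt expr1n divff. Qed.

Lemma tsin_ge0 t : 0 <= t -> 0 <= tsin t.
Proof. by move=> t0; rewrite mulr_ge0// ltW ?twt_gt0. Qed.

Lemma tsin_gt0 t : 0 < t -> 0 < tsin t.
Proof. by move=> t0; rewrite mulr_gt0// ?twt_gt0. Qed.

Lemma tsin_le1 t : tsin t <= 1.
Proof.
rewrite /tsin /twt mulrA ler_pdivrMr ?sqrD1_gt0// mul1r -subr_ge0.
have -> : 1 + t ^+ 2 - t * 2 = (t - 1) ^+ 2 by ring.
exact: sqr_ge0.
Qed.

Lemma tsin_lt1 t : t < 1 -> tsin t < 1.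
Proof.
move=> t1; rewrite /tsin /twt mulrA ltr_pdivrMr ?sqrD1_gt0// mul1r -subr_gt0.
have -> : 1 + t ^+ 2 - t * 2 = (1 - t) ^+ 2 by ring.
by rewrite exprn_gt0// subr_gt0.
Qed.

Lemma twt_le2 t : twt t <= 2.
Proof.
by rewrite -[leRHS](twtE t) ler_peMr ?lerDl ?sqr_ge0// ltW ?twt_gt0.
Qed.

Lemma tcos_ge0 t : 0 <= t <= 1 -> 0 <= tcos t.
Proof.
move=> /andP[t0 t1]; rewrite subr_ge0 /twt ler_pdivlMr ?sqrD1_gt0// mul1r.
by rewrite -natr1 addrC lerD2r// exprn_ile1.
Qed.

Lemma tsin_ge t : 0 <= t <= 1 -> t <= tsin t.
Proof.
move=> t01; rewrite -subr_ge0; have -> : tsin t - t = t * tcos t.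
  by rewrite /tsin /tcos; ring.
by rewrite mulr_ge0 ?tcos_ge0//; case/andP: t01.
Qed.

Lemma tsin_homo r t : 0 <= t <= r -> r <= 1 -> tsin t <= tsin r.
Proof.
move=> /andP[t0 tr] r1; rewrite /tsin /twt !mulrA.
rewrite ler_pdivrMr ?sqrD1_gt0// mulrAC ler_pdivlMr ?sqrD1_gt0// -subr_ge0.
have -> : r * 2 * (1 + t ^+ 2) - t * 2 * (1 + r ^+ 2) = 2 * ((r - t) * (1 - r * t)).
  by ring.
by rewrite !mulr_ge0 ?subr_ge0// mulr_ile1// ?(le_trans t0)// (le_trans tr).
Qed.

(** [cphi] and [spsi] are phi_n and psi_n, with c = [tcos t] and x = [tsin t]. *)
Definition cphi n t : R := tcos t * tsin t ^+ (2 * n + 1) / ((2 * n + 1)%:R * cbin R n).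
Definition spsi n t : R := tsin t ^+ (2 * n + 1) / cbin R n.

(** This is theta psi_n = (2n+1)^2 phi_n divided by t. The division is carried out by replacing one
    factor x = t [twt t] of phi_n by [twt t], so that t = 0 is covered. *)
Lemma is_derive_spsi n t :
  is_derive t 1 (spsi n) ((2 * n + 1)%:R ^+ 2 *
    (twt t * tcos t * tsin t ^+ (2 * n) / ((2 * n + 1)%:R * cbin R n))).
Proof.
have b0 : cbin R n != 0 by rewrite gt_eqF ?cbin_gt0.
rewrite /spsi addn1; under eq_fun do rewrite mulrC.
apply: is_derive_eq (is_derive_cmulf _ (is_derive_powf _ (is_derive_tsin t))) _.
have n0 : 1 + 2 * n%:R != 0 :> R by rewrite -natrM addrC natr1 pnatr_eq0.
by field; rewrite b0.
Qed.

(** This is theta phi_n = psi_n - psi_(n+1), again with t divided out. Since c^2 = 1 - x^2,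
    differentiation produces (2n+1) c^2 - x^2 = (2n+1) - (2n+2) x^2, and the recurrence of b_n turns
    the two terms into a difference of consecutive psi. *)
Lemma is_derive_cphi n t :
  is_derive t 1 (cphi n)
    (twt t * (tsin t ^+ (2 * n) / cbin R n - tsin t ^+ (2 * n.+1) / cbin R n.+1)).
Proof.
have b0 : cbin R n != 0 by rewrite gt_eqF ?cbin_gt0.
have n0 : 2 * n%:R + 1 != 0 :> R by rewrite -natrM natr1 pnatr_eq0.
have m0 : 2 * n%:R + 1 + 1 != 0 :> R by rewrite -natrM !natr1 pnatr_eq0.
have -> : cbin R n.+1 = (2 * n + 1)%:R * cbin R n / (2 * n + 2)%:R.
  by rewrite -cbinS mulrC mulKf// addn2 pnatr_eq0.
rewrite /cphi; under eq_fun do rewrite mulrC addn1.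
apply: is_derive_eq (is_derive_cmulf _ (is_derive_mulf (is_derive_tcos t)
  (is_derive_powf _ (is_derive_tsin t)))) _.
rewrite mulnS exprD exprS -(addn1 (2 * n)).
have -> : (2 * n + 2)%:R = (2 * n + 1)%:R + 1 :> R by rewrite natr1 addn1 addn2.
have := tcos_sqr t.
set c := tcos t; set x := tsin t => hc.
have -> : - (x * twt t) * (x * x ^+ (2 * n)) + c * ((2 * n + 1)%:R * x ^+ (2 * n) * (twt t * c))
  = twt t * x ^+ (2 * n) * ((2 * n + 1)%:R * c ^+ 2 - x ^+ 2) by ring.
by rewrite hc; field; rewrite b0 n0 m0.
Qed.

End TanHalf.

(** * Exponential growth against powers *)

Section Growth.
Variable R : realType.
Implicit Types (q y : R) (p n N : nat).

(** A single term of the exponential series. It serves for geometric decay, with y = -(n+1) ln q,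
    and for logarithms near 0, with y = -ln x. *)
Lemma exprn_le_fact_expR p y : 0 <= y -> y ^+ p <= p`!%:R * expR y.
Proof.
move=> y0; case: p => [|p].
  by rewrite expr0 mul1r (le_trans _ (expR_ge1Dx y))// lerDl.
rewrite mulrC -ler_pdivrMr ?ltr0n ?fact_gt0//.
by rewrite (le_trans _ (expR_ge1Dxn p y0))// lerDr.
Qed.

Lemma poly_geometric_le p q : 0 < q < 1 ->
  exists C : R, forall n, n.+1%:R ^+ p * q ^+ n <= C * harmonic n.
Proof.
move=> /andP[q0 q1]; have a0 : 0 < - ln q by rewrite oppr_gt0 ln_lt0// q0.
(* The exponent p + 1 leaves a spare factor 1/(n+1); the division by q compensates for q^(n+1) in
   place of q^n. *)
exists ((p.+1)`!%:R / (- ln q) ^+ p.+1 / q) => n; rewrite /harmonic /=.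
have := @exprn_le_fact_expR p.+1 (n.+1%:R * - ln q).
rewrite mulr_ge0 ?(ltW a0)// => /(_ isT).
have -> : expR (n.+1%:R * - ln q) = (q ^+ n.+1)^-1.
  by rewrite mulrN expRN mulr_natl -lnXn// lnK// posrE exprn_gt0.
rewrite ler_pdivlMr ?exprn_gt0// exprMn => h.
rewrite !ler_pdivlMr ?exprn_gt0 ?ltr0n//; apply: le_trans h.
rewrite le_eqVlt; apply/orP; left; apply/eqP.
by rewrite (exprSr n.+1%:R) (exprSr q); ring.
Qed.

End Growth.

(** * Partial sums of the series and their derivatives *)

Section Comparison.
Variable R : realType.
Implicit Types (j k n m N s : nat) (q r t : R).

Lemma cbin_le1 n : cbin R n <= 1.
Proof.
elim: n => [|n IH]; first by rewrite /cbin muln0 bin0 expr0 divr1.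
have n2 : 0 < (2 * n + 2)%:R :> R by rewrite ltr0n addn2.
rewrite -(ler_pM2l n2) cbinS ler_pM ?ler_nat ?ler0n ?leq_add2l//.
by rewrite ltW ?cbin_gt0.
Qed.

(** The sequence (2n+1) b_n = (2n+2) b_(n+1) is nondecreasing. Hence 1/b_n grows at most
    linearly. *)
Lemma cbin_ge n : 1 <= (2 * n + 1)%:R * cbin R n.
Proof.
elim: n => [|n IH]; first by rewrite /cbin muln0 bin0 expr0 divr1 mul1r.
rewrite (le_trans IH)// -cbinS ler_pM2r ?cbin_gt0// ler_nat.
by rewrite mulnS addn1 (addnC 2%N) leqnSn.
Qed.

Lemma nested_ge0 j n : 0 <= nested R j.+1 n.
Proof.
elim: j n => [|j IH] n; rewrite (nested1E, nestedSE) sumr_ge0// => m _.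
  by rewrite divr_ge0// ltW ?cbin_gt0.
by rewrite divr_ge0// exprn_ge0.
Qed.

Lemma nested_le j n : nested R j.+1 n <= n%:R ^+ j.+1.
Proof.
elim: j n => [|j IH] n.
  rewrite nested1E expr1 -[in leRHS](subn0 n) -sumr_const_nat.
  apply: ler_sum => m _; rewrite ler_pdivrMr ?ltr0n ?addn1// mul1r.
  by rewrite (le_trans (cbin_le1 _))// ler1n.
rewrite nestedSE exprS mulr_natl -[in leRHS](subn0 n) -sumr_const_nat subn0.
rewrite big_seq [leRHS]big_seq; apply: ler_sum => m.
rewrite mem_index_iota => /= mn; rewrite ler_pdivrMr; last first.
  by rewrite exprn_gt0// ltr0n addn1.
rewrite (le_trans (IH _))// -[leLHS]mulr1 ler_pM ?exprn_ge0 ?ler01//.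
  by rewrite lerXn2r ?nnegrE ?ler_nat.
by rewrite exprn_ege1// ler1n addn1.
Qed.

(** For q = x this is the boundary term S_(j+1)(N) psi_N of the Abel summation with one factor x
    removed. *)
Definition tail j q N : R := nested R j.+1 N * q ^+ (2 * N) / cbin R N.

Lemma tail_ge0 j q N : 0 <= q -> 0 <= tail j q N.
Proof.
move=> q0; rewrite /tail divr_ge0 ?(ltW (cbin_gt0 _ _))//.
by rewrite mulr_ge0 ?exprn_ge0// nested_ge0.
Qed.

Lemma tail_cvg j q : 0 < q < 1 -> tail j q N @[N --> \oo] --> (0 : R).
Proof.
(* The power j + 1 absorbs [nested R j.+1 N] and one more absorbs 1/b_N; the estimate is used at
   index 2N. *)
move=> q01; have [C hC] := poly_geometric_le j.+2 q01.
have q0 : 0 <= q by case/andP: q01 => /ltW.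
have C0 : 0 <= C.
  have := hC 0%N; rewrite expr0 mulr1 expr1n /harmonic/= invr1 mulr1.
  exact: le_trans.
have h N : 0 <= tail j q N <= C * harmonic N.
  rewrite tail_ge0//= (@le_trans _ _ (C * harmonic (2 * N)))//; last first.
    by rewrite ler_wpM2l// lef_pV2 ?posrE ?ltr0n// ler_nat ltnS leq_pmull.
  apply: le_trans (hC _); rewrite exprSr -addn1 /tail.
  rewrite ler_pdivrMr ?cbin_gt0// -!mulrA.
  rewrite ler_pM ?nested_ge0 ?exprn_ge0//.
    rewrite (le_trans (nested_le _ _))// lerXn2r ?nnegrE// ler_nat.
    by rewrite (@leq_trans (2 * N)) ?leq_pmull ?leq_addr.
  by rewrite mulrCA ler_peMr ?exprn_ge0// cbin_ge.
apply: (@squeeze_cvgr _ _ _ _ (cst 0) (fun N => C * harmonic N)).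
- by near=> N; rewrite /= h.
- exact: cvg_cst.
- by rewrite -[X in _ --> X](mulr0 C); apply: cvgMr; exact: cvg_harmonic.
Unshelve. all: by end_near.
Qed.

Definition chi_sum s N t : R := \sum_(0 <= m < N) t ^+ (2 * m + 1) / (2 * m + 1)%:R ^+ s.

Definition phi_sum j N t : R := \sum_(0 <= n < N) nested R j n.+1 * cphi n t.

(** What Abel summation makes of the sum of S_j(n+1) (psi_n - psi_(n+1)), apart from the boundary
    term. *)
Definition psi_sum j N t : R :=
  \sum_(0 <= n < N) (nested R j n.+1 - nested R j n) * spsi n t.

Lemma is_derive_chi_sum s N t : is_derive t 1 (chi_sum s.+1 N)
  (\sum_(0 <= m < N) t ^+ (2 * m) / (2 * m + 1)%:R ^+ s).
Proof.
rewrite /chi_sum.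
apply: (@is_derive_sumf _ _ (fun m t => t ^+ (2 * m + 1) / (2 * m + 1)%:R ^+ s.+1)) => m.
rewrite addn1; under eq_fun do rewrite mulrC.
apply: is_derive_eq (is_derive_cmulf _ (is_derive_powf _ (is_derive_id _ _))) _.
have n0 : (2 * m).+1%:R != 0 :> R by rewrite pnatr_eq0.
by rewrite mulr1 exprS invfM mulrCA !mulrA divff// mul1r mulrC.
Qed.

Lemma chi_sumE s N t :
  chi_sum s N t = t * \sum_(0 <= m < N) t ^+ (2 * m) / (2 * m + 1)%:R ^+ s.
Proof.
by rewrite mulr_sumr; apply: eq_bigr => m _; rewrite addn1 exprS mulrA.
Qed.

(** Abel summation by induction on [N], starting from S_(j+1)(0) = 0. After multiplication by t it
    reads theta [phi_sum] = [psi_sum] - x [tail]. *)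
Lemma is_derive_phi_sum j N t : is_derive t 1 (phi_sum j.+1 N)
  (twt t * (\sum_(0 <= n < N) (nested R j.+1 n.+1 - nested R j.+1 n) *
      (tsin t ^+ (2 * n) / cbin R n) - tail j (tsin t) N)).
Proof.
rewrite /phi_sum; apply: is_derive_eq.
  apply: (@is_derive_sumf _ _ (fun n t => nested R j.+1 n.+1 * cphi n t)) => n.
  exact: is_derive_cmulf (is_derive_cphi n t).
elim: N => [|N IH].
  by rewrite !big_geq// /tail nested0 !mul0r subr0 mulr0.
by rewrite !big_nat_recr//= IH /tail; ring.
Qed.

Lemma psi_sumE j N t : psi_sum j N t = tsin t *
  \sum_(0 <= n < N) (nested R j n.+1 - nested R j n) * (tsin t ^+ (2 * n) / cbin R n).
Proof.
by rewrite mulr_sumr; apply: eq_bigr => m _; rewrite /spsi addn1 exprS; ring.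
Qed.

(** The increments b_n/(2n+1) cancel the weights, so [psi_sum 1 N] is the truncated series of artanh
    x and its derivative a geometric sum in x^2. *)
Lemma is_derive_psi_sum1 N t : is_derive t 1 (psi_sum 1 N)
  (\sum_(0 <= n < N) twt t * tcos t * tsin t ^+ (2 * n)).
Proof.
rewrite /psi_sum.
apply: (@is_derive_sumf _ _ (fun n t => (nested R 1 n.+1 - nested R 1 n) * spsi n t)) => n.
apply: is_derive_eq (is_derive_cmulf _ (is_derive_spsi n t)) _.
rewrite nested1S.
have b0 : cbin R n != 0 by rewrite gt_eqF ?cbin_gt0.
have n0 : 2 * n%:R + 1 != 0 :> R by rewrite -natrM natr1 pnatr_eq0.
by field; rewrite b0 n0.
Qed.

(** The increments S_(j+1)(n+1)/(2n+1)^2 cancel the factor (2n+1)^2 of theta psi_n. Thus theta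
    [psi_sum j.+2 N] is exactly [phi_sum j.+1 N], without boundary term. *)
Lemma is_derive_psi_sumS j N t : is_derive t 1 (psi_sum j.+2 N)
  (\sum_(0 <= n < N) nested R j.+1 n.+1 *
    (twt t * tcos t * tsin t ^+ (2 * n) / ((2 * n + 1)%:R * cbin R n))).
Proof.
rewrite /psi_sum.
apply: (@is_derive_sumf _ _ (fun n t => (nested R j.+2 n.+1 - nested R j.+2 n) * spsi n t)) => n.
apply: is_derive_eq (is_derive_cmulf _ (is_derive_spsi n t)) _.
rewrite nestedS.
have b0 : cbin R n != 0 by rewrite gt_eqF ?cbin_gt0.
have n0 : 2 * n%:R + 1 != 0 :> R by rewrite -natrM natr1 pnatr_eq0.
by field; rewrite b0 n0.
Qed.

Lemma phi_sumE j N t : phi_sum j.+1 N t = t * \sum_(0 <= n < N) nested R j.+1 n.+1 *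
    (twt t * tcos t * tsin t ^+ (2 * n) / ((2 * n + 1)%:R * cbin R n)).
Proof.
rewrite mulr_sumr; apply: eq_bigr => n _.
by rewrite /cphi addn1 exprS {1}/tsin; ring.
Qed.

End Comparison.

(** * Error estimates and the limit of the partial sums on [0, 1) *)

Section Limit.
Variable R : realType.
Implicit Types (j k n m N s : nat) (q r t : R).

Lemma sum_sqr_powers N (x : R) :
  (1 - x ^+ 2) * \sum_(0 <= n < N) x ^+ (2 * n) = 1 - x ^+ (2 * N).
Proof.
elim: N => [|N IH]; first by rewrite big_geq// mulr0 muln0 expr0 subrr.
by rewrite big_nat_recr//= mulrDr IH mulnS exprD; ring.
Qed.

Lemma twt_tcos t : twt t * (1 - t ^+ 2) = 2 * tcos t.
Proof.
have -> : twt t * (1 - t ^+ 2) = twt t *+ 2 - twt t * (1 + t ^+ 2) by ring.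
by rewrite twtE /tcos; ring.
Qed.

(** The truncated form of artanh x = 2 artanh t. Under theta both sides become geometric sums with
    the same limit, leaving 2t/(1 - t^2) times t^(2N) - x^(2N), which is small because t <= x <=
    [tsin r] < 1. *)
Lemma psi_sum1_close r N t : 0 < r < 1 -> 0 <= t <= r ->
  `|psi_sum 1 N t - 2 * chi_sum 1 N t| <= (2 / (1 - r ^+ 2) * tsin r ^+ (2 * N)) * t.
Proof.
move=> /andP[r0 r1]; move: t.
pose D t := \sum_(0 <= n < N) twt t * tcos t * tsin t ^+ (2 * n)
  + (- 2) * \sum_(0 <= m < N) t ^+ (2 * m) / (2 * m + 1)%:R ^+ 0.
apply: (@normr_le_of_derive _ _ D) => [s||t /andP[t0 tr]].
- under eq_fun do rewrite -mulNr.
  exact: is_derive_addf (is_derive_psi_sum1 N s)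
    (is_derive_cmulf _ (is_derive_chi_sum 0 N s)).
- by rewrite psi_sumE chi_sumE tsin0 !mul0r mulr0 subr0.
have tr2 : t ^+ 2 <= r ^+ 2 by rewrite lerXn2r// nnegrE ltW.
have r2 : 0 < 1 - r ^+ 2 by rewrite subr_gt0 exprn_ilt1// ltW.
have t2 : 0 < 1 - t ^+ 2 by rewrite (lt_le_trans r2)// lerD2l lerN2.
(* Multiplication by 1 - t^2 closes both geometric sums at once: [twt t] (1 - t^2) = 2c supplies the
   second c needed for c^2 = 1 - x^2. *)
have E : (1 - t ^+ 2) * (t * D t) = - 2 * t * (tsin t ^+ (2 * N) - t ^+ (2 * N)).
  have -> : tsin t ^+ (2 * N) - t ^+ (2 * N) =
      (1 - t ^+ (2 * N)) - (1 - tsin t ^+ (2 * N)) by ring.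
  rewrite -!sum_sqr_powers -tcos_sqr /D -mulr_sumr.
  under [X in (- 2) * X]eq_bigr do rewrite expr0 divr1.
  set a := \sum_(0 <= n < N) tsin t ^+ _; set b := \sum_(0 <= n < N) t ^+ _.
  have -> : (1 - t ^+ 2) * (t * (twt t * tcos t * a + - 2 * b)) =
    (twt t * (1 - t ^+ 2)) * t * tcos t * a - 2 * t * (1 - t ^+ 2) * b by ring.
  by rewrite twt_tcos; ring.
have xr : tsin t ^+ (2 * N) <= tsin r ^+ (2 * N).
  by rewrite lerXn2r ?nnegrE ?tsin_ge0 ?(ltW t0) ?(ltW r0)// tsin_homo// ltW//= ltW.
have tx : t ^+ (2 * N) <= tsin t ^+ (2 * N).
  rewrite lerXn2r ?nnegrE ?tsin_ge0 ?(ltW t0)// tsin_ge// (ltW t0)/=.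
  by rewrite (le_trans tr)// ltW.
rewrite -(ler_pM2l t2) -{1}(gtr0_norm t2) -normrM E.
rewrite normrM mulNr normrN !ger0_norm ?subr_ge0 ?mulr_ge0// ?(ltW t0)//.
rewrite -[leLHS]mulrA.
apply: (@le_trans _ _ (2 * (t * tsin r ^+ (2 * N)))).
  rewrite ler_wpM2l// ler_wpM2l ?(ltW t0)// (le_trans _ xr)// gerBl.
  by rewrite exprn_ge0// ltW.
have -> : (1 - t ^+ 2) * (2 / (1 - r ^+ 2) * tsin r ^+ (2 * N) * t)
  = ((1 - t ^+ 2) / (1 - r ^+ 2)) * (2 * (t * tsin r ^+ (2 * N))) by ring.
rewrite ler_peMl//; last by rewrite ler_pdivlMr// mul1r lerD2l lerN2.
by rewrite !mulr_ge0// ?exprn_ge0 ?tsin_ge0 ?(ltW t0) ?(ltW r0).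
Qed.

(** Going from psi to phi raises the order of chi by one and costs the boundary term x [tail], at
    most 2t [tail j (tsin r) N] since x <= 2t and x <= [tsin r]. *)
Lemma phi_sum_close j s r N (e : R) : 0 < r < 1 ->
  (forall t, 0 <= t <= r ->
    `|psi_sum j.+1 N t - 2 * chi_sum s N t| <= e * t) ->
  forall t, 0 <= t <= r ->
    `|phi_sum j.+1 N t - 2 * chi_sum s.+1 N t| <= (e + 2 * tail j (tsin r) N) * t.
Proof.
move=> /andP[r0 r1] h.
pose D t := (twt t * (\sum_(0 <= n < N) (nested R j.+1 n.+1 - nested R j.+1 n) *
      (tsin t ^+ (2 * n) / cbin R n) - tail j (tsin t) N))
  + (- 2) * \sum_(0 <= m < N) t ^+ (2 * m) / (2 * m + 1)%:R ^+ s.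
apply: (@normr_le_of_derive _ _ D) => [t||t /andP[t0 tr]].
- under eq_fun do rewrite -mulNr.
  exact: is_derive_addf (is_derive_phi_sum j N t)
    (is_derive_cmulf _ (is_derive_chi_sum s N t)).
- by rewrite phi_sumE chi_sumE !mul0r mulr0 subr0.
have -> : t * D t = (psi_sum j.+1 N t - 2 * chi_sum s N t) - tsin t * tail j (tsin t) N.
  by rewrite psi_sumE chi_sumE /D /tsin; ring.
rewrite (le_trans (ler_normB _ _))// [leRHS]mulrDl lerD ?h ?(ltW t0)//.
have x0 : 0 <= tsin t by rewrite tsin_ge0// ltW.
rewrite ger0_norm; last exact: mulr_ge0 x0 (tail_ge0 _ _ x0).
rewrite [leRHS]mulrAC ler_pM ?tail_ge0//.
  by rewrite mulrC ler_wpM2l ?twt_le2// ltW.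
rewrite ler_wpM2r ?invr_ge0 ?(ltW (cbin_gt0 _ _))// ler_wpM2l ?nested_ge0//.
by rewrite lerXn2r ?nnegrE ?tsin_ge0 ?(ltW t0) ?(ltW r0)// tsin_homo// ltW//= ltW.
Qed.

(** Going from phi to the next psi has no boundary term, so the error constant is unchanged. *)
Lemma psi_sum_close j s r N (e : R) : 0 < r < 1 ->
  (forall t, 0 <= t <= r ->
    `|phi_sum j.+1 N t - 2 * chi_sum s N t| <= e * t) ->
  forall t, 0 <= t <= r ->
    `|psi_sum j.+2 N t - 2 * chi_sum s.+1 N t| <= e * t.
Proof.
move=> /andP[r0 r1] h.
pose D t := (\sum_(0 <= n < N) nested R j.+1 n.+1 *
    (twt t * tcos t * tsin t ^+ (2 * n) / ((2 * n + 1)%:R * cbin R n)))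
  + (- 2) * \sum_(0 <= m < N) t ^+ (2 * m) / (2 * m + 1)%:R ^+ s.
apply: (@normr_le_of_derive _ _ D) => [t||t /andP[t0 tr]].
- under eq_fun do rewrite -mulNr.
  exact: is_derive_addf (is_derive_psi_sumS j N t)
    (is_derive_cmulf _ (is_derive_chi_sum s N t)).
- by rewrite psi_sumE chi_sumE tsin0 !mul0r mulr0 subr0.
have -> : t * D t = phi_sum j.+1 N t - 2 * chi_sum s N t.
  by rewrite phi_sumE chi_sumE /D; ring.
by rewrite h// (ltW t0).
Qed.

(** The two steps alternate, starting from [psi_sum 1] against chi_1; each increase of [j] raises
    the order by two and adds one tail. The tails vanish in the limit because [tsin r] < 1. *)
Lemma phi_chi_close j r : 0 < r < 1 -> exists2 e : nat -> R,
  e @ \oo --> (0 : R) &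
  forall N t, 0 <= t <= r ->
    `|phi_sum j.+1 N t - 2 * chi_sum (2 * j.+1) N t| <= e N * t.
Proof.
move=> r01; have /andP[r0 r1] := r01.
have q01 : 0 < tsin r < 1 by rewrite tsin_gt0//= tsin_lt1.
have tail2 i : 2 * tail i (tsin r) N @[N --> \oo] --> (0 : R).
  by rewrite -[X in _ --> X](mulr0 2); apply: cvgMr; exact: tail_cvg.
elim: j => [|j [e e0 IH]].
  exists (fun N => 2 / (1 - r ^+ 2) * tsin r ^+ (2 * N) + 2 * tail 0 (tsin r) N).
    rewrite -[X in _ --> X]addr0; apply: cvgD => //.
    rewrite -[X in _ --> X](mulr0 (2 / (1 - r ^+ 2))); apply: cvgMr.
    under eq_fun do rewrite exprM.
    apply: cvg_expr; rewrite ger0_norm ?sqr_ge0// exprn_ilt1//.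
      by rewrite ltW//; case/andP: q01.
    by case/andP: q01.
  move=> N; rewrite muln1.
  by apply: phi_sum_close => // t tr; exact: psi_sum1_close.
exists (fun N => e N + 2 * tail j.+1 (tsin r) N).
  by rewrite -[X in _ --> X]addr0; apply: cvgD.
move=> N; rewrite mulnS add2n.
by apply: phi_sum_close => //; apply: psi_sum_close => //; exact: IH.
Qed.

(** Comparison with the telescoping sum of 1/(m(m+1)). The factor t is kept because it later
    compensates the logarithm at t = 0. *)
Lemma chi_sum_le s N t : 0 <= t <= 1 -> chi_sum s.+2 N t <= 2 * t.
Proof.
move=> /andP[t0 t1]; rewrite chi_sumE mulrC ler_wpM2r//.
(* For N = 0 the inverse is 0 by convention; the telescoping starts at N = 1. *)
suff h : \sum_(0 <= m < N) t ^+ (2 * m) / (2 * m + 1)%:R ^+ s.+2 <= 2 - (N%:R)^-1.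
  by rewrite (le_trans h)// gerBl.
elim: N => [|[|N] IH]; first by rewrite big_geq// invr0 subr0.
  rewrite big_nat1 muln0 expr0 add0n expr1n invr1 mul1r.
  by lra.
rewrite big_nat_recr//= (le_trans (lerD IH (lexx _)))//.
have n1 : 0 < N.+1%:R :> R by [].
have h : t ^+ (2 * N.+1) / (2 * N.+1 + 1)%:R ^+ s.+2 <= (N.+1%:R * N.+2%:R)^-1 :> R.
  rewrite ler_pdivrMr ?exprn_gt0 ?ltr0n ?addn1//.
  rewrite ler_pdivlMl ?mulr_gt0//.
  rewrite (@le_trans _ _ (N.+1%:R * N.+2%:R))//.
    by rewrite ler_piMr ?mulr_ge0// exprn_ile1.
  rewrite -natrM -natrX ler_nat !expnS mulnA.
  rewrite -[leqLHS]muln1 leq_mul ?expn_gt0//.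
  by apply: leq_mul; rewrite ltnS ?leq_pmull// (leq_trans (leqnSn N))// leq_pmull.
rewrite (le_trans (lerD (lexx _) h))// -[N.+2%:R]natr1.
rewrite le_eqVlt; apply/orP; left; apply/eqP.
have [m0 m1] : 1 + N%:R + 1 != 0 :> R /\ 1 + N%:R != 0 :> R.
  by rewrite (addrC 1) !natr1 !pnatr_eq0.
by field; rewrite m0 m1.
Qed.

Lemma chi_sum_homo s t : 0 <= t -> nondecreasing_seq (fun N => chi_sum s N t).
Proof.
move=> t0; apply/nondecreasing_seqP => n.
by rewrite /chi_sum big_nat_recr//= lerDl divr_ge0// exprn_ge0.
Qed.

Lemma chi_sum_cvg s t : 0 <= t <= 1 ->
  chi_sum s.+2 N t @[N --> \oo] --> legendre_chi s.+2 t.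
Proof.
move=> t01; have t0 : 0 <= t by case/andP: t01.
have e N : \sum_(1 <= n < N.+1) t ^+ (2 * n - 1) / (2 * n - 1)%:R ^+ s.+2 =
    chi_sum s.+2 N t.
  rewrite big_add1 /= /chi_sum; apply: eq_bigr => m _.
  by rewrite mulnS add2n subn1 addn1.
rewrite /legendre_chi; rewrite (eq_fun e).
apply: nondecreasing_is_cvgn; first exact: (@chi_sum_homo _ _ t0).
by exists (2 * t) => _ [N _ <-]; exact: chi_sum_le.
Qed.

Lemma legendre_chi_le s t : 0 <= t <= 1 -> legendre_chi s.+2 t <= 2 * t.
Proof.
move=> t01; have h := @chi_sum_cvg s t t01.
rewrite -(cvg_lim _ h)//; apply: limr_le; first by apply/cvg_ex; eexists; exact: h.
by near=> N; exact: chi_sum_le.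
Unshelve. all: by end_near.
Qed.

Lemma phi_sum_cvg j t : 0 <= t < 1 ->
  phi_sum j.+1 N t @[N --> \oo] --> 2 * legendre_chi (2 * j.+1) t.
Proof.
(* Any r in (0, 1) with t <= r would do; the midpoint stays positive at t = 0. *)
move=> /andP[t0 t1]; pose r : R := (t + 1) / 2.
have r01 : 0 < r < 1 by rewrite /r; apply/andP; split; lra.
have tr : 0 <= t <= r by rewrite /r; apply/andP; split; lra.
have [e e0 h] := @phi_chi_close j r r01.
have c : 2 * chi_sum (2 * j.+1) N t @[N --> \oo] --> 2 * legendre_chi (2 * j.+1) t.
  apply: cvgMr; rewrite mulnS add2n; apply: chi_sum_cvg.
  by rewrite t0 ltW.
rewrite -[X in _ --> X]add0r.
rewrite [X in X @ _ --> _](_ : _ = fun N =>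
  (phi_sum j.+1 N t - 2 * chi_sum (2 * j.+1) N t) + 2 * chi_sum (2 * j.+1) N t).
  apply: cvgD c; apply: norm_cvg0.
   apply: (@squeeze_cvgr _ _ _ _ (cst 0) (fun N => e N * t)).
  - by near=> N; rewrite /= normr_ge0/= h.
  - exact: cvg_cst.
  - by rewrite -[X in _ --> X](mul0r t); exact: cvgMl.
by apply/funext => N; rewrite subrK.
Unshelve. all: by end_near.
Qed.

End Limit.

(** * Logarithmic moments, pulled back along x = [tsin t] *)

Section LogMoments.
Variable R : realType.
Implicit Types (m n p : nat) (t x : R).

(* [ln] is 0 on nonpositive reals, so this is continuous on the whole line. *)
Definition xlnX p x : R := x * (- ln x) ^+ p.

(** For x > 0, square and use (-ln x)^(2p) <= (2p)!/x. For x <= 0 the logarithm is 0 and only p = 0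
    can contribute. *)
Lemma xlnX_near0 p x : `|x| < 1 -> `|xlnX p x| <= Num.sqrt ((2 * p)`!%:R * `|x|).
Proof.
move=> x1; have [x0|x0] := leP x 0.
  apply: (@le_trans _ _ `|x|).
    rewrite /xlnX ln0// oppr0 normrM normrX normr0 ler_piMr//.
    by rewrite expr0n; case: p => [|p] /=; rewrite ?ler01.
  rewrite -[leLHS]sqrtr_sqr ler_wsqrtr// expr2 (le_trans (ler_norm _))// normrM.
  by rewrite ler_wpM2r// (le_trans (ltW x1))// ler1n fact_gt0.
rewrite /xlnX; have l0 : 0 <= - ln x by rewrite oppr_ge0 ln_le0// ltW// -(gtr0_norm x0).
rewrite (gtr0_norm x0) ger0_norm; last by rewrite mulr_ge0 ?exprn_ge0// ltW.
rewrite -(ler_pXn2r (n := 2)) ?nnegrE ?sqrtr_ge0//; last by rewrite mulr_ge0 ?exprn_ge0// ltW.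
rewrite sqr_sqrtr; last by rewrite mulr_ge0// ltW.
have := exprn_le_fact_expR (2 * p) l0; rewrite expRN lnK ?posrE//.
rewrite ler_pdivlMr// => h.
rewrite exprMn -exprM expr2 -mulrA mulrC ler_wpM2r ?(ltW x0)//.
by rewrite mulrC (mulnC p).
Qed.

Lemma continuous_xlnX p : continuous (xlnX p).
Proof.
move=> x; have [x0|x0|->] := ltgtP x 0.
- have E y : y < 0 -> y * (- 0) ^+ p = xlnX p y.
    by move=> y0; rewrite /xlnX ln0// ltW.
  have h : {near x, (fun y => y * (- 0) ^+ p) =1 xlnX p}.
    by near=> y; apply: E; near: y; exact: lt_nbhsl.
  apply: cvg_trans (near_eq_cvg h) _.
  by rewrite -E//; apply: cvgMl; exact: cvg_id.
- apply: cvgM; first exact: cvg_id.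
  apply: (@continuous_comp _ _ _ (fun y => - ln y) (fun y => y ^+ p)).
    by apply: cvgN; exact: continuous_ln.
  exact: exprn_continuous.
- rewrite /continuous_at {2}/xlnX mul0r; apply: norm_cvg0.
  apply: (@squeeze_cvgr _ _ _ _ (cst 0) (fun y => Num.sqrt ((2 * p)`!%:R * `|y|))).
  + have := @nbhs0_lt R R 1 ltr01; apply: filter_app; near=> y => y1.
    by rewrite /= normr_ge0/= xlnX_near0.
  + exact: cvg_cst.
  + rewrite -[X in _ --> X](sqrtr0 R).
    apply: continuous_cvg; first exact: sqrt_continuous.
    rewrite -[X in _ --> X](mulr0 (2 * p)`!%:R); apply: cvgMr.
    by rewrite -[X in _ --> X](normr0 R); apply: cvg_norm.
Unshelve. all: by end_near.
Qed.

(** The antiderivative of x^m (-ln x)^p given by p integrations by parts, expressed through [xlnX]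
    to be continuous at 0. *)
Fixpoint prim m p x : R :=
  if p is p'.+1 then
    x ^+ m * xlnX p x / m.+1%:R + p%:R / m.+1%:R * prim m p' x
  else x ^+ m.+1 / m.+1%:R.

Lemma continuous_prim m p : continuous (prim m p).
Proof.
elim: p => [|p IH] x /=.
  by apply: cvgMl; exact: exprn_continuous.
apply: cvgD; last by apply: cvgMr; exact: IH.
by apply: cvgMl; apply: cvgM; [exact: exprn_continuous|exact: continuous_xlnX].
Qed.

Lemma is_derive_prim m p x : 0 < x ->
  is_derive x 1 (prim m p) (x ^+ m * (- ln x) ^+ p).
Proof.
move=> x0; have m0 : m%:R + 1 != 0 :> R by rewrite natr1 pnatr_eq0.
have x0' : x != 0 by rewrite gt_eqF.
elim: p => [|p IH] /=.
  under eq_fun do rewrite mulrC.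
  apply: is_derive_eq (is_derive_cmulf _ (is_derive_powf _ (is_derive_id _ _))) _.
  by rewrite !mulr1 mulKf// -natr1.
have -> : (fun x => x ^+ m * xlnX p.+1 x / m.+1%:R + p.+1%:R / m.+1%:R * prim m p x) =
  (fun x : R => m.+1%:R^-1 * (x ^+ m.+1 * (- 1 * ln x) ^+ p.+1) + p.+1%:R / m.+1%:R * prim m p x).
  by apply/funext => y; rewrite /xlnX mulrA -exprSr mulN1r mulrC.
apply: is_derive_eq (is_derive_addf (is_derive_cmulf _ (is_derive_mulf
  (is_derive_powf _ (is_derive_id _ _)) (is_derive_powf _ (is_derive_cmulf _ (is_derive1_ln x0)))))
  (is_derive_cmulf _ IH)) _.
by rewrite !mulN1r (exprS x) (exprS (- ln x)) -natr1; field; rewrite m0.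
Qed.

Lemma prim0 m p : prim m p 0 = 0.
Proof.
elim: p => [|p IH] /=; first by rewrite expr0n mul0r.
by rewrite IH /xlnX mul0r !mulr0 mul0r addr0.
Qed.

Lemma prim1 m p : prim m p 1 = p`!%:R / m.+1%:R ^+ p.+1.
Proof.
elim: p => [|p IH] /=; first by rewrite expr1n fact0 expr1.
rewrite IH /xlnX ln1 oppr0 expr0n /= !mulr0 mul0r add0r factS natrM.
by rewrite mulf_div -exprS.
Qed.

(** The pullback of x^m (-ln x)^p dx, with dx/dt = [twt t * tcos t]. *)
Definition weight m p t : R := tsin t ^+ m * (- ln (tsin t)) ^+ p * (twt t * tcos t).

Lemma continuous_tsin : continuous (@tsin R).
Proof. by move=> t; exact: is_derive_continuous (is_derive_tsin t). Qed.

Lemma continuous_twt : continuous (@twt R).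
Proof. by move=> t; exact: is_derive_continuous (is_derive_twt t). Qed.

Lemma continuous_tcos : continuous (@tcos R).
Proof. by move=> t; exact: is_derive_continuous (is_derive_tcos t). Qed.

(** One factor x is joined to the logarithm to form [xlnX], whence the exponent [m.+1]. *)
Lemma continuous_weight m p : continuous (weight m.+1 p).
Proof.
have -> : weight m.+1 p = fun t => tsin t ^+ m * xlnX p (tsin t) * (twt t * tcos t).
  by apply/funext => t; rewrite /weight /xlnX exprSr !mulrA.
move=> t; apply: cvgM.
  apply: cvgM.
    apply: (@continuous_comp _ _ _ (@tsin R) (fun y => y ^+ m)).
      exact: continuous_tsin.
    exact: exprn_continuous.
  apply: (@continuous_comp _ _ _ (@tsin R) (xlnX p)).
    exact: continuous_tsin.
  exact: continuous_xlnX.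
by apply: cvgM; [exact: continuous_twt|exact: continuous_tcos].
Qed.

Lemma integrable_weight m p :
  (@lebesgue_measure R).-integrable `[0, 1] (EFin \o weight m.+1 p).
Proof.
apply: continuous_compact_integrable; first exact: segment_compact.
by apply: continuous_subspaceT; exact: continuous_weight.
Qed.

Lemma integral_weight m p :
  \int[@lebesgue_measure R]_(t in `[0, 1]) weight m.+1 p t =
  p`!%:R / m.+2%:R ^+ p.+1.
Proof.
have cF : continuous (prim m.+1 p \o @tsin R).
  move=> t; apply: continuous_comp; [exact: continuous_tsin|exact: continuous_prim].
rewrite /Rintegral (@continuous_FTC2 _ _ (prim m.+1 p \o @tsin R))//=.
- by rewrite tsin0 tsin1 prim0 prim1 subr0.
- by apply: continuous_subspaceT; exact: continuous_weight.
- split; [|apply: cvg_at_right_filter; exact: cF|apply: cvg_at_left_filter; exact: cF].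
  move=> t; rewrite in_itv/= => /andP[t0 t1].
  have := is_derive1_comp (is_derive_prim m.+1 p (tsin_gt0 t0)) (is_derive_tsin t).
  by case.
move=> t; rewrite in_itv/= => /andP[t0 t1].
have := is_derive1_comp (is_derive_prim m.+1 p (tsin_gt0 t0)) (is_derive_tsin t).
by rewrite derive1E => d; rewrite derive_val.
Qed.

End LogMoments.

(** * Termwise integration by dominated convergence *)

Section Integration.
Variable R : realType.
Implicit Types (j n p N : nat) (t : R).
Local Notation mu := (@lebesgue_measure R).

(** The factor 1/4 is chosen so that the limit 2 chi of [phi_sum], times [twt t / 4], becomes chi/(1
    + t^2). *)
Definition partial_integrand j p N t : R :=
  \sum_(0 <= n < N) nested R j.+1 n.+1 / (4 * ((2 * n + 1)%:R * cbin R n)) *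
    weight (2 * n).+1 p t.

Lemma partial_integrandE j p N t : partial_integrand j p N t =
  (- ln (tsin t)) ^+ p * phi_sum j.+1 N t * (twt t / 4).
Proof.
rewrite /phi_sum mulr_sumr mulr_suml; apply: eq_bigr => n _.
by rewrite /weight /cphi addn1 invfM; ring.
Qed.

Lemma integrable_partial_integrand j p N :
  mu.-integrable `[0, 1] (EFin \o partial_integrand j p N).
Proof.
rewrite [X in mu.-integrable _ X](_ : _ = fun t => (\sum_(0 <= n < N)
   (nested R j.+1 n.+1 / (4 * ((2 * n + 1)%:R * cbin R n)))%:E *
    (EFin \o weight (2 * n).+1 p) t)%E); last first.
  by apply/funext => t /=; rewrite /partial_integrand -sumEFin.
by apply: integrable_sum => // n _; apply: integrableZl => //; exact: integrable_weight.
Qed.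

Lemma integral_partial_integrand j p N :
  \int[mu]_(t in `[0, 1]) partial_integrand j p N t =
  \sum_(0 <= n < N) nested R j.+1 n.+1 / (4 * ((2 * n + 1)%:R * cbin R n)) *
    (p`!%:R / (2 * n).+2%:R ^+ p.+1).
Proof.
elim: N => [|N IH].
  under eq_Rintegral do rewrite /partial_integrand big_geq//.
  by rewrite big_geq// /Rintegral integral0.
rewrite big_nat_recr//= -IH -integral_weight -RintegralZl//; last exact: integrable_weight.
rewrite -RintegralD//; first last.
- exact: (integrableZl (mu := mu) (measurable_itv `[0, 1]) _ (integrable_weight R (2 * N) p)).
- exact: integrable_partial_integrand.
by apply: eq_Rintegral => t _; rewrite /partial_integrand big_nat_recr.
Qed.

Definition integrand j p t : R :=
  (- ln (tsin t)) ^+ p * legendre_chi (2 * j.+1) t * (twt t / 2).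

Lemma measurable_integrand j p : measurable_fun (`[0, 1] : set R) (integrand j p).
Proof.
apply: measurable_funM; first apply: measurable_funM.
- apply: measurable_funX; apply: measurable_funTS.
  apply: measurableT_comp => //; apply: measurableT_comp; first exact: measurable_ln.
  by apply: continuous_measurable_fun; exact: continuous_tsin.
- apply: (@measurable_fun_cvg _ _ _ _ (fun N => chi_sum (2 * j.+1) N)) => [N|t].
    apply: measurable_funTS; apply: measurable_sum => n.
    by apply: measurable_funM => //; exact: measurable_funX.
  by rewrite /= in_itv/= mulnS add2n; exact: chi_sum_cvg.
- apply: measurable_funTS; apply: measurable_funM => //.
  by apply: continuous_measurable_fun; exact: continuous_twt.
Qed.

Lemma partial_integrand_cvg j p t : 0 <= t < 1 ->
  partial_integrand j p N t @[N --> \oo] --> integrand j p t.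
Proof.
move=> t01; under eq_fun do rewrite partial_integrandE.
have -> : integrand j p t = (- ln (tsin t)) ^+ p * (2 * legendre_chi (2 * j.+1) t) *
    (twt t / 4) by rewrite /integrand; field.
by apply: cvgMl; apply: cvgMr; exact: phi_sum_cvg.
Qed.

Lemma cphi_ge0 n t : 0 <= t <= 1 -> 0 <= cphi n t.
Proof.
move=> t01; rewrite divr_ge0 ?mulr_ge0 ?exprn_ge0 ?tcos_ge0 ?(ltW (cbin_gt0 _ _))//.
by rewrite tsin_ge0//; case/andP: t01.
Qed.

Lemma phi_sum_ge0 j N t : 0 <= t <= 1 -> 0 <= phi_sum j.+1 N t.
Proof.
by move=> t01; apply: sumr_ge0 => n _; rewrite mulr_ge0 ?nested_ge0 ?cphi_ge0.
Qed.

Lemma phi_sum_le j N t : 0 <= t <= 1 -> phi_sum j.+1 N t <= 4 * t.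
Proof.
move=> t01; have /andP[t0] := t01; rewrite le_eqVlt => /predU1P[->|t1].
  (* At t = 1 every term vanishes because c = 0; below 1 the increasing partial sums stay under
     their limit 2 chi. *)
  rewrite /phi_sum big1 ?mulr1// => n _.
  by rewrite /cphi /tcos /twt expr1n divff// subrr !mul0r mulr0.
have c := @phi_sum_cvg _ j t; rewrite t0 t1 in c; have {}c := c isT.
apply: (@le_trans _ _ (2 * legendre_chi (2 * j.+1) t)).
  rewrite -(cvg_lim _ c)//; apply: nondecreasing_cvgn_le; last first.
    by apply/cvg_ex; eexists; exact: c.
  apply/nondecreasing_seqP => n; rewrite /phi_sum big_nat_recr//= lerDl.
  by rewrite mulr_ge0 ?nested_ge0 ?cphi_ge0.
have := @legendre_chi_le _ (2 * j) _ t01; rewrite mulnS add2n => h.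
by rewrite (le_trans (ler_wpM2l _ h))// mulrA -natrM.
Qed.

(** The bound 4t on [phi_sum] times [twt t / 4] is exactly x, so x (-ln x)^p is a continuous
    majorant independent of [N]. *)
Lemma partial_integrand_bound j p N t : 0 <= t <= 1 ->
  `|partial_integrand j p N t| <= xlnX p (tsin t).
Proof.
move=> t01; have /andP[t0 t1] := t01.
have l0 : 0 <= (- ln (tsin t)) ^+ p by rewrite exprn_ge0// oppr_ge0 ln_le0// tsin_le1.
have w0 := ltW (twt_gt0 t).
rewrite partial_integrandE ger0_norm; last first.
  by rewrite mulr_ge0 ?(divr_ge0 w0)// mulr_ge0// phi_sum_ge0.
have -> : xlnX p (tsin t) = (- ln (tsin t)) ^+ p * (4 * t) * (twt t / 4).
  by rewrite /xlnX {1}/tsin; field.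
by rewrite ler_wpM2r ?(divr_ge0 w0)// ler_wpM2l// phi_sum_le.
Qed.

Lemma dominated_integrand j p :
  mu.-integrable `[0, 1] (EFin \o integrand j p) /\
  \int[mu]_(t in `[0, 1]) partial_integrand j p N t @[N --> \oo] -->
    \int[mu]_(t in `[0, 1]) integrand j p t.
Proof.
have [|||||i _ c] := dominated_convergence (mu := mu) (measurable_itv `[0, 1])
  (f_ := fun N => EFin \o partial_integrand j p N) (f := EFin \o integrand j p)
  (g := EFin \o (fun t => xlnX p (tsin t))).
- by move=> N; case/integrableP: (integrable_partial_integrand j p N).
- by apply/measurable_EFinP; exact: measurable_integrand.
(* At t = 1 all partial sums are 0 through the factor c, so convergence is claimed only off this
   null set. *)
- exists [set 1]; split; [exact: measurable_set1|exact: lebesgue_measure_set1|].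
  move=> t /= h; apply: contrapT => t1; apply: h => t01; apply: cvg_EFin.
    by near=> N.
  apply: partial_integrand_cvg; move: t01; rewrite in_itv/= => /andP[-> t1'] /=.
  by rewrite lt_neqAle t1' andbT; apply/eqP.
- apply: continuous_compact_integrable; first exact: segment_compact.
  apply: continuous_subspaceT => t.
  by apply: (@continuous_comp _ _ _ (@tsin R) (xlnX p));
    [exact: continuous_tsin|exact: continuous_xlnX].
- apply: aeW => t n /=; rewrite in_itv/= => t01; rewrite lee_fin.
  exact: partial_integrand_bound.
split => //; rewrite -(fineK (integrable_fin_num _ i)) in c; last exact: measurable_itv.
exact: (fine_cvg c).
Unshelve. all: by end_near.
Qed.

End Integration.

(** * Identification of the partial sums of the series with these integrals *)

Theorem theorem3p8 (R : realType) (j k : nat) (hj : (0 < j)%N) (hk : (0 < k)%N) :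
  let f : R -> R := fun t =>
    ln ((1 + t ^+ 2) / (2 * t)) ^+ (k - 1) * legendre_chi (2 * j) t
      / (1 + t ^+ 2) in
  (@lebesgue_measure R).-integrable `[0, 1] (EFin \o f) /\
  (fun N : nat => \sum_(1 <= n < N.+1)
     4 ^+ n / (n%:R ^+ (k + 1) * 'C(2 * n, n)%:R) * inner_sum R j n)
    @ \oo -->
  2 ^+ (k + 3) / ((k - 1)`!)%:R * \int[@lebesgue_measure R]_(t in `[0, 1]) f t.
Proof.
case: j hj => [//|j] _; case: k hk => [//|p] _ f.
have fE : {in `[0, 1]%classic, integrand j p =1 f}.
  move=> t; rewrite inE/= in_itv/= => /andP[t0 _]; rewrite /f /integrand subn1 /=.
  congr (_ ^+ _ * _ * _); last by rewrite /twt; field; rewrite gt_eqF ?sqrD1_gt0.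
  have -> : (1 + t ^+ 2) / (2 * t) = (tsin t)^-1.
    by rewrite /tsin /twt mulrA invf_div (mulrC t).
  (* At t = 0 both logarithms are 0 by default, the inverse of 0 being 0. *)
  move: t0; rewrite le_eqVlt => /predU1P[<-|t0]; last by rewrite lnV// posrE tsin_gt0.
  by rewrite tsin0 invr0 ln0// oppr0.
have [i c] := dominated_integrand R j p; split.
  by apply: eq_integrable i => // t t01 /=; rewrite fE.
have -> : \int[@lebesgue_measure R]_(t in `[0, 1]) f t =
    \int[@lebesgue_measure R]_(t in `[0, 1]) integrand j p t.
  by apply: eq_Rintegral => t t01; rewrite fE.
rewrite subn1 /= addSn.
have E N : \sum_(1 <= n < N.+1)
      4 ^+ n / (n%:R ^+ (p.+1 + 1) * 'C(2 * n, n)%:R) * inner_sum R j.+1 n =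
    2 ^+ (p + 3).+1 / p`!%:R *
      \int[@lebesgue_measure R]_(t in `[0, 1]) partial_integrand j p N t; last first.
  by rewrite (eq_fun E); exact: cvgMr.
rewrite big_add1 integral_partial_integrand mulr_sumr /=.
apply: eq_bigr => n _; rewrite inner_sumE.
have b0 : cbin R n != 0 by rewrite gt_eqF ?cbin_gt0.
have n0 : 2 * n%:R + 1 != 0 :> R by rewrite -natrM natr1 pnatr_eq0.
have m0 : n%:R + 1 != 0 :> R by rewrite natr1 pnatr_eq0.
have f0 : p`!%:R != 0 :> R by rewrite pnatr_eq0 -lt0n fact_gt0.
(* After the shift n -> n + 1 the coefficient contains 1/b_(n+1), which the recurrence expresses
   through b_n; the powers of 2 then balance. *)
have -> : 4 ^+ n.+1 / (n.+1%:R ^+ (p.+1 + 1) * 'C(2 * n.+1, n.+1)%:R) =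
    (n.+1%:R ^+ p.+2 * cbin R n.+1)^-1 :> R.
  by rewrite /cbin addn1 mulrA invf_div.
have -> : cbin R n.+1 = (2 * n + 1)%:R * cbin R n / (2 * n + 2)%:R.
  by rewrite -cbinS mulrC mulKf// addn2 pnatr_eq0.
have -> : (2 * n + 2)%:R = 2 * n.+1%:R :> R by rewrite -natrM mulnS addnC.
have -> : (2 * n).+2%:R = 2 * n.+1%:R :> R by rewrite -natrM mulnS add2n.
rewrite exprMn (exprS _ p.+1) addn3 !(exprS 2) -natr1.
have m1 : (n%:R + 1) ^+ p.+1 != 0 :> R by rewrite expf_neq0.
have p2 : 2 ^+ p != 0 :> R by rewrite expf_neq0.
by field; rewrite m1 p2 b0 n0 f0 m0.
Qed.
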